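(* For $F\equiv1\pmod 2$, the following equality holds: $$\mathcal{H}_{q}^{\chi}(s:x:a:F\mid\alpha)=\frac{[2:q]\,q^{a}(-1)^{a}\chi(a)}{[F:q^{\alpha}]^{s}}\;\widetilde{\zeta}_{E,q^{F}}\!\left(s,\frac{x+a}{F}\,\Big|\,\alpha\right).$$
   Context: Here $q\in\mathbb{C}$ with $|q|<1$, $[y:q]=\frac{q^{y}-1}{q-1}$ (so $[y:q^{\alpha}]$ is the same expression with $q$ replaced by $q^{\alpha}$), $\alpha\in\mathbb{N}\cup\{0\}$ is the weight, $s\in\mathbb{C}$, and $\chi$ is a Dirichlet character with odd conductor $d\in\mathbb{N}$. The partial Dirichlet type zeta function is $$\mathcal{H}_{q}^{\chi}(s:x:a:F\mid\alpha)=[2:q]\sum_{m\equiv a\,(\mathrm{mod}\,F)}^{\infty}\frac{q^{m}\chi(m)(-1)^{m}}{[x+m:q^{\alpha}]^{s}},$$ where the sum runs over $m=a,\,a+F,\,a+2F,\dots$. The weighted $q$-Euler Hurwitz-zeta type function is $$\widetilde{\zeta}_{E,q}(s,x\mid\alpha)=[2:q]\sum_{m=0}^{\infty}\frac{(-1)^{m}q^{m}}{[m+x:q^{\alpha}]^{s}},$$ and $\widetilde{\zeta}_{E,q^{F}}$ denotes this function with $q$ replaced by $q^{F}$.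
   Formalization: The printed equality is false: the factor [2:q] must be [2:q]/[2:q^F], and F must be a multiple of the conductor d. Also q≠0 with a fixed logarithm, powers are principal, and x satisfies |q^{x+a}|<1 (e.g. real x+a>0), which keeps brackets nonzero. *)

(* Defs.v *)
From Stdlib Require Import Reals ZArith Arith.
From Coquelicot Require Import Coquelicot.

Open Scope C_scope.

Definition natC (n : nat) : C := RtoC (INR n).

Definition cexp (z : C) : C :=
  ((exp (Re z) * cos (Im z))%R, (exp (Re z) * sin (Im z))%R).

(* Principal argument, with values in (-PI, PI] for z <> 0. *)
Definition carg (z : C) : R :=
  if Rle_dec 0 (Im z) then acos (Re z / Cmod z) else (- acos (Re z / Cmod z))%R.

Definition clog (z : C) : C := (ln (Cmod z), carg z).

(* Principal value of z ^ s; meaningful for z <> 0 only. *)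
Definition cpow (z s : C) : C := cexp (s * clog z).

(* Sum of a complex series, through real and imaginary parts. *)
Definition CSeries (u : nat -> C) : C :=
  (Series (fun n => Re (u n)), Series (fun n => Im (u n))).

(* The bases q, q^alpha, q^F, ... are passed through a logarithm l, because
   q^y := exp (l y) needs one for complex y.  If l is the logarithm chosen for
   q, then the one for q^k is k l, so that (q^k)^y = q^(k y) for all y. *)

(* [y : q] with q = exp l.  At q = 1 (the base q^alpha with alpha = 0) the
   quotient is replaced by its limit y. *)
Definition qbracket (l y : C) : C :=
  if Ceq_dec (cexp l) 1 then y else (cexp (l * y) - 1) / (cexp l - 1).

(* chi is a Dirichlet character modulo d, extended by 0 to all integers. *)
Record dirichlet_character (d : nat) (chi : Z -> C) : Prop := {
  dirichlet_modulus : (0 < d)%nat;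
  dirichlet_periodic : forall n : Z, chi (n + Z.of_nat d)%Z = chi n;
  dirichlet_mult : forall m n : Z, chi (m * n)%Z = chi m * chi n;
  dirichlet_support : forall n : Z, chi n <> 0 <-> Z.gcd n (Z.of_nat d) = 1%Z
}.

Definition induced_modulus (d : nat) (chi : Z -> C) (e : nat) : Prop :=
  forall n : Z, Z.gcd n (Z.of_nat d) = 1%Z ->
    (n mod Z.of_nat e = 1 mod Z.of_nat e)%Z -> chi n = 1.

(* A character of conductor d is taken as a (primitive) character modulo its
   conductor: no proper divisor of d is an induced modulus. *)
Definition character_of_conductor (d : nat) (chi : Z -> C) : Prop :=
  dirichlet_character d chi /\
  forall e : nat, Nat.divide e d -> induced_modulus d chi e -> e = d.

(* Sum over m = a, a + F, a + 2 F, ... *)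
Definition partial_zeta (l : C) (chi : Z -> C) (s x : C) (a F alpha : nat) : C :=
  qbracket l 2 *
  CSeries (fun n : nat =>
    let m := (a + n * F)%nat in
    cexp l ^ m * chi (Z.of_nat m) * (-1) ^ m
      / cpow (qbracket (natC alpha * l) (x + natC m)) s).

Definition euler_hurwitz_zeta (l s x : C) (alpha : nat) : C :=
  qbracket l 2 *
  CSeries (fun m : nat =>
    (-1) ^ m * cexp l ^ m / cpow (qbracket (natC alpha * l) (natC m + x)) s).

(* Main.v *)
Require Import Defs.
From Stdlib Require Import Reals ZArith Arith.
From Coquelicot Require Import Coquelicot.
From Stdlib Require Import Lra Lia.

(** The proof reindexes the series: writing m = a + n F and
    y = (x + a) / F, the m-th summand of the partial zeta function should be
    a constant times the n-th summand of the Hurwitz zeta function for the base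
    q^F.  Periodicity of chi modulo d, a divisor of F, gives chi(m) = chi(a);
    oddness of F gives (-1)^(n F) = (-1)^n; and the brackets factor as
      [x + m : q^alpha] = [F : q^alpha] [n + y : q^(alpha F)].
    Two points need more than algebra.

    The first is that the factorization must survive raising to the power s,
    although principal powers are not multiplicative.  Put w = q^alpha with
    alpha > 0.  Since |w| < 1, |w^F| < 1 and |w^(x+m)| < 1, the numbers
    1 - w, 1 - w^F and 1 - w^(x+m) all lie in the right half-plane, so their
    arguments B, C, A lie in (-PI/2, PI/2).  The principal arguments of the
    three brackets are therefore exactly A - B, C - B and A - C, with no
    multiple of 2 PI, and they add up.  For alpha = 0 one factor is the positive
    number F and the other is nonzero.  This is [clog_qbracket_rescale].

    The second is that a complex constant can be pulled out of the series only
    if it converges: the product mixes real and imaginary parts.  The brackets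
    are bounded away from 0 and grow at most linearly
    ([qbracket_shift_bounds]), so the powers cost at most a factor exp(e n) with
    e as small as desired, which the geometric factor q^(F n) absorbs
    ([ex_series_geometric_over_cpow]).

    The conditions |q| < 1 and |q^(x+a)| < 1 are used in the logarithmic form
    Re l < 0 and Re (l (x + a)) < 0. *)

Open Scope C_scope.

(** * The complex exponential *)

Lemma cexp_plus (z w : C) : cexp (z + w) = cexp z * cexp w.
Proof.
  unfold cexp, Cmult, Re, Im; simpl.
  rewrite exp_plus, cos_plus, sin_plus.
  apply injective_projections; simpl; ring.
Qed.

Lemma cexp_0 : cexp 0 = 1.
Proof.
  unfold cexp; simpl. rewrite exp_0, cos_0, sin_0.
  apply injective_projections; simpl; ring.
Qed.

Lemma Cmod_cexp (z : C) : Cmod (cexp z) = exp (Re z).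
Proof.
  unfold Cmod, cexp; simpl.
  replace (_ + _)%R with (Rsqr (exp (Re z)) * (Rsqr (sin (Im z)) + Rsqr (cos (Im z))))%R
    by (unfold Rsqr; ring).
  rewrite sin2_cos2, Rmult_1_r. apply sqrt_Rsqr, Rlt_le, exp_pos.
Qed.

Lemma cexp_neq_0 (z : C) : cexp z <> 0.
Proof.
  intros H. apply (f_equal Cmod) in H.
  rewrite Cmod_cexp, Cmod_0 in H. generalize (exp_pos (Re z)); lra.
Qed.

Lemma cexp_opp (z : C) : cexp (- z) = / cexp z.
Proof.
  assert (H : cexp (- z) * cexp z = 1).
  { rewrite <- cexp_plus, <- cexp_0. f_equal. ring. }
  rewrite <- (Cmult_1_l (/ cexp z)), <- H. field. apply cexp_neq_0.
Qed.

Lemma cexp_natC_mult (n : nat) (z : C) : cexp (natC n * z) = cexp z ^ n.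
Proof.
  induction n as [|n IH].
  - unfold natC; simpl. rewrite Cmult_0_l. apply cexp_0.
  - rewrite Cpow_S, <- IH, <- cexp_plus. f_equal.
    unfold natC. rewrite S_INR, RtoC_plus. ring.
Qed.

Lemma Re_natC_mult (n : nat) (z : C) : Re (natC n * z) = (INR n * Re z)%R.
Proof. unfold natC, Re; simpl; ring. Qed.

Lemma Cmod_cexp_lt_1 (z : C) : (Cmod (cexp z) < 1)%R <-> (Re z < 0)%R.
Proof.
  rewrite Cmod_cexp, <- exp_0. split.
  - apply exp_lt_inv.
  - apply exp_increasing.
Qed.

Lemma exp_nondecreasing (u v : R) : (u <= v)%R -> (exp u <= exp v)%R.
Proof.
  intros [H | ->]; [now apply Rlt_le, exp_increasing | apply Rle_refl].
Qed.

Lemma natC_neq_0 (n : nat) : (0 < n)%nat -> natC n <> 0.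
Proof.
  intros Hn H. apply RtoC_inj in H. apply lt_0_INR in Hn. lra.
Qed.

(** * The principal logarithm *)

Lemma clog_cexp (t : C) :
  (- PI < Im t <= PI)%R -> clog (cexp t) = t.
Proof.
  intros [Hl Hu]. unfold clog. rewrite Cmod_cexp, ln_exp.
  apply injective_projections; simpl; [reflexivity|].
  unfold carg. rewrite Cmod_cexp. simpl.
  assert (He := exp_pos (Re t)).
  replace (exp (Re t) * cos (Im t) / exp (Re t))%R with (cos (Im t))
    by (field; lra).
  destruct (Rle_dec 0 (exp (Re t) * sin (Im t))) as [H|H].
  - apply acos_cos. split; [|exact Hu].
    destruct (Rle_dec 0 (Im t)) as [Hp|Hp]; [exact Hp|].
    assert (sin (- Im t) > 0)%R by (apply sin_gt_0; lra).
    rewrite sin_neg in *. nra.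
  - destruct (Rle_dec 0 (Im t)) as [Hp|Hp].
    + exfalso. apply H. apply Rmult_le_pos; [lra|]. apply sin_ge_0; lra.
    + rewrite <- cos_neg, acos_cos by lra. unfold Im in *; lra.
Qed.

Lemma Im_clog_bounds (z : C) : (- PI <= Im (clog z) <= PI)%R.
Proof.
  unfold clog, carg; simpl. assert (H := acos_bound (Re z / Cmod z)).
  assert (HP := PI_RGT_0).
  destruct (Rle_dec 0 (Im z)); lra.
Qed.

Lemma cexp_clog (z : C) : z <> 0 -> cexp (clog z) = z.
Proof.
  intros Hz. assert (Hm : (0 < Cmod z)%R) by now apply Cmod_gt_0.
  assert (Hsq : (Cmod z * Cmod z = Re z * Re z + Im z * Im z)%R).
  { unfold Cmod. rewrite sqrt_sqrt by nra. unfold Re, Im. ring. }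
  set (c := (Re z / Cmod z)%R).
  assert (Hc : (Re z = Cmod z * c)%R) by (unfold c; field; lra).
  assert (Hb : (-1 <= c <= 1)%R).
  { assert (H := re_le_Cmod z). apply Rabs_le_between in H. rewrite Hc in H.
    split; nra. }
  assert (Hs : (Cmod z * sqrt (1 - Rsqr c) = Rabs (Im z))%R).
  { rewrite <- (sqrt_Rsqr (Cmod z)) at 1 by lra.
    rewrite <- sqrt_mult_alt by apply Rle_0_sqr.
    rewrite <- sqrt_Rsqr_abs. f_equal. unfold Rsqr.
    transitivity (Cmod z * Cmod z - (Cmod z * c) * (Cmod z * c))%R; [ring|].
    rewrite Hsq, <- Hc. ring. }
  unfold cexp, clog, carg; simpl. fold c. rewrite exp_ln by exact Hm.
  apply injective_projections; simpl; destruct (Rle_dec 0 (Im z)) as [Hi|Hi].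
  - rewrite cos_acos by exact Hb. now rewrite <- Hc.
  - rewrite cos_neg, cos_acos by exact Hb. now rewrite <- Hc.
  - rewrite sin_acos by exact Hb. rewrite Hs. now apply Rabs_pos_eq.
  - rewrite sin_neg, sin_acos by exact Hb.
    rewrite Ropp_mult_distr_r_reverse, Hs, Rabs_left by lra.
    unfold Im; ring.
Qed.

Lemma right_half_plane_neq_0 (z : C) : (0 < Re z)%R -> z <> 0.
Proof. intros Hz ->. simpl in Hz. lra. Qed.

(** A nonpositive cosine would be forced by an argument outside
    (-PI/2, PI/2), but the cosine has the sign of Re z. *)
Lemma Im_clog_right_half_plane (z : C) :
  (0 < Re z)%R -> (- (PI / 2) < Im (clog z) < PI / 2)%R.
Proof.
  intros Hz.
  assert (Hz0 := right_half_plane_neq_0 z Hz).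
  assert (Hb := Im_clog_bounds z).
  assert (He := f_equal Re (cexp_clog z Hz0)). simpl in He.
  assert (Hp := exp_pos (Re (clog z))). simpl in Hp.
  set (t := Im (clog z)) in *. change (carg z) with t in He.
  assert (Hc : (0 < cos t)%R) by nra.
  assert (HP := PI_RGT_0).
  split; apply Rnot_le_lt; intros H.
  - assert (cos (- t) <= 0)%R by (apply cos_le_0; lra).
    rewrite cos_neg in *. lra.
  - assert (cos t <= 0)%R by (apply cos_le_0; lra). lra.
Qed.

(** The difference of two arguments in (-PI/2, PI/2) stays in (-PI, PI), the
    range on which the principal logarithm inverts the exponential. *)
Lemma clog_div_right_half_plane (z w : C) :
  (0 < Re z)%R -> (0 < Re w)%R -> clog (z / w) = clog z - clog w.
Proof.
  intros Hz Hw.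
  assert (Hz0 := right_half_plane_neq_0 z Hz).
  assert (Hw0 := right_half_plane_neq_0 w Hw).
  rewrite <- (clog_cexp (clog z - clog w)).
  - unfold Cminus. rewrite cexp_plus, cexp_opp, !cexp_clog by assumption.
    reflexivity.
  - assert (H1 := Im_clog_right_half_plane z Hz).
    assert (H2 := Im_clog_right_half_plane w Hw).
    change (Im (clog z - clog w)) with (Im (clog z) - Im (clog w))%R. lra.
Qed.

Lemma clog_mult_pos (r : R) (z : C) :
  (0 < r)%R -> z <> 0 -> clog (RtoC r * z) = clog (RtoC r) + clog z.
Proof.
  intros Hr Hz. unfold clog. 
  rewrite Cmod_mult, Cmod_R, (Rabs_pos_eq r) by lra.
  assert (Hm : (0 < Cmod z)%R) by now apply Cmod_gt_0.
  apply injective_projections; simpl.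
  - now apply ln_mult.
  - unfold carg. rewrite Cmod_mult, Cmod_R, (Rabs_pos_eq r), re_scal_l by lra.
    replace (Im (r * z)) with (r * Im z)%R by (unfold Im; simpl; ring).
    replace (r * Re z / (r * Cmod z))%R with (Re z / Cmod z)%R by (field; lra).
    simpl. destruct (Rle_dec 0 0) as [_|H]; [|lra].
    replace (r / r)%R with 1%R by (field; lra). rewrite acos_1, Rplus_0_l.
    destruct (Rle_dec 0 (r * Im z)), (Rle_dec 0 (Im z)); try reflexivity;
      exfalso; nra.
Qed.

(** * Brackets and their logarithms *)

Lemma Re_one_minus_cexp_pos (z : C) : (Re z < 0)%R -> (0 < Re (1 - cexp z))%R.
Proof.
  intros Hz. apply Cmod_cexp_lt_1 in Hz.
  assert (H := re_le_Cmod (cexp z)). apply Rabs_le_between in H.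
  change (Re (1 - cexp z)) with (1 - Re (cexp z))%R. lra.
Qed.

Lemma cexp_neq_1 (z : C) : (Re z < 0)%R -> cexp z <> 1.
Proof.
  intros Hz H. apply Re_one_minus_cexp_pos in Hz. rewrite H in Hz.
  simpl in Hz. lra.
Qed.

(** Changing both signs makes numerator and denominator lie in the right
    half-plane, where principal logarithms can be subtracted. *)
Lemma qbracket_contracting (l y : C) :
  (Re l < 0)%R -> qbracket l y = (1 - cexp (l * y)) / (1 - cexp l).
Proof.
  intros Hl. unfold qbracket.
  destruct (Ceq_dec (cexp l) 1) as [E|E]; [now apply cexp_neq_1 in E|].
  assert (H1 : 1 - cexp l <> 0)
    by now apply right_half_plane_neq_0, Re_one_minus_cexp_pos.
  field. split; [exact H1|].
  intros H. apply H1. replace (1 - cexp l) with (- (cexp l - 1)) by ring.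
  rewrite H. ring.
Qed.

Lemma qbracket_weight_0 (l y : C) : qbracket (natC 0 * l) y = y.
Proof.
  unfold qbracket, natC; simpl. rewrite Cmult_0_l, cexp_0.
  destruct (Ceq_dec 1 1) as [_|E]; [reflexivity | now contradict E].
Qed.

Lemma Re_natC_mult_neg (n : nat) (z : C) :
  (0 < n)%nat -> (Re z < 0)%R -> (Re (natC n * z) < 0)%R.
Proof.
  intros Hn Hz. rewrite Re_natC_mult. apply lt_0_INR in Hn. nra.
Qed.

Lemma clog_qbracket (l y : C) :
  (Re l < 0)%R -> (Re (l * y) < 0)%R ->
  clog (qbracket l y) = clog (1 - cexp (l * y)) - clog (1 - cexp l).
Proof.
  intros Hl Hy. rewrite qbracket_contracting by exact Hl.
  apply clog_div_right_half_plane; now apply Re_one_minus_cexp_pos.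
Qed.

(** For positive alpha the terms clog (1 - cexp (alpha l F)) of the two factors
    cancel; for alpha = 0 the factor F is a positive real number. *)
Lemma clog_qbracket_rescale (l y : C) (F alpha : nat) :
  (0 < F)%nat -> (Re l < 0)%R -> (Re (l * y) < 0)%R ->
  clog (qbracket (natC alpha * l) y) =
    clog (qbracket (natC alpha * l) (natC F)) +
    clog (qbracket (natC alpha * (natC F * l)) (y / natC F)).
Proof.
  intros HF Hl Hy. assert (HF0 := natC_neq_0 F HF).
  destruct alpha as [|alpha].
  - rewrite !qbracket_weight_0.
    transitivity (clog (natC F * (y / natC F))).
    { f_equal. field. exact HF0. }
    apply clog_mult_pos.
    + now apply lt_0_INR.
    (* y = 0 is excluded because l y has negative real part. *)
    + intros H. assert (E : y = natC F * (y / natC F)) by (field; exact HF0).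
      rewrite H, Cmult_0_r in E. rewrite E, Cmult_0_r in Hy. simpl in Hy. lra.
  - set (n := S alpha). assert (Hn : (0 < n)%nat) by (unfold n; lia).
    assert (E : natC n * (natC F * l) * (y / natC F) = natC n * l * y)
      by (field; exact HF0).
    assert (E' : natC n * (natC F * l) = natC n * l * natC F) by ring.
    assert (H1 : (Re (natC n * l) < 0)%R) by now apply Re_natC_mult_neg.
    assert (H2 : (Re (natC n * l * y) < 0)%R).
    { rewrite <- Cmult_assoc. now apply Re_natC_mult_neg. }
    assert (H3 : (Re (natC n * (natC F * l)) < 0)%R).
    { apply Re_natC_mult_neg; [exact Hn|]. now apply Re_natC_mult_neg. }
    rewrite !clog_qbracket; rewrite ?E; try assumption.
    + rewrite E'. ring.
    + now rewrite <- E'.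
Qed.

Lemma cpow_qbracket_rescale (l y s : C) (F alpha : nat) :
  (0 < F)%nat -> (Re l < 0)%R -> (Re (l * y) < 0)%R ->
  cpow (qbracket (natC alpha * l) y) s =
    cpow (qbracket (natC alpha * l) (natC F)) s *
    cpow (qbracket (natC alpha * (natC F * l)) (y / natC F)) s.
Proof.
  intros HF Hl Hy. unfold cpow.
  rewrite (clog_qbracket_rescale l y F alpha HF Hl Hy), <- cexp_plus.
  f_equal. ring.
Qed.

(** * Convergence *)

Lemma CSeries_scal_l (c : C) (u : nat -> C) :
  ex_series (fun n => Cmod (u n)) ->
  CSeries (fun n => c * u n) = c * CSeries u.
Proof.
  intros Hu.
  assert (HR : ex_series (fun n => Re (u n))).
  { apply (ex_series_le (V := R_CompleteNormedModule) _ _ (fun n => re_le_Cmod (u n))). exact Hu. }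
  assert (HI : ex_series (fun n => Im (u n))).
  { apply (ex_series_le (V := R_CompleteNormedModule) _ (fun n => Cmod (u n))); [|exact Hu].
    intros n. eapply Rle_trans; [apply Rmax_r | apply Rmax_Cmod]. }
  unfold CSeries, Cmult; simpl.
  rewrite <- !Series_scal_l, <- Series_minus, <- Series_plus;
    try (now apply (ex_series_scal_l (V := R_NormedModule))).
  reflexivity.
Qed.

Lemma CSeries_ext (u v : nat -> C) :
  (forall n, u n = v n) -> CSeries u = CSeries v.
Proof.
  intros H. unfold CSeries. f_equal; apply Series_ext; intros n; now rewrite H.
Qed.

(** The slope e is arbitrary: the upper bound is ln (e t) <= e t - 1. *)
Lemma abs_ln_le_linear (c K e t n : R) :
  (0 < c)%R -> (0 < e)%R -> (0 <= K)%R -> (0 <= n)%R -> (c <= t <= K + n)%R ->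
  (Rabs (ln t) <= Rabs (ln c) + Rabs (ln e) + e * K + e * n)%R.
Proof.
  intros Hc He HK Hn [Hl Hu].
  assert (H1 : (ln c <= ln t)%R) by (apply ln_le; lra).
  assert (H2 : (ln t <= e * t - ln e)%R).
  { assert (Ht := exp_ineq1_le (ln (e * t))).
    rewrite exp_ln in Ht by nra. rewrite ln_mult in Ht by lra. lra. }
  assert (e * t <= e * K + e * n)%R by nra.
  assert (0 <= e * K)%R by nra. assert (0 <= e * n)%R by nra.
  assert (Hc1 := Rabs_pos (ln c)). assert (He1 := Rabs_pos (ln e)).
  assert (Hc2 := Rle_abs (- ln c)). rewrite Rabs_Ropp in Hc2.
  assert (He2 := Rle_abs (- ln e)). rewrite Rabs_Ropp in He2.
  apply Rabs_le. lra.
Qed.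

(** The modulus of z^s is exp (Re s * ln |z| - Im s * arg z).  The argument is
    bounded, and the logarithm grows slower than any linear function, hence
    slower than the decay rate of the powers of cexp l. *)
Lemma ex_series_geometric_over_cpow (l s : C) (z : nat -> C) (c K : R) :
  (Re l < 0)%R -> (0 < c)%R ->
  (forall n, c <= Cmod (z n) <= K + INR n)%R ->
  ex_series (fun n => Cmod ((-1) ^ n * cexp l ^ n / cpow (z n) s)).
Proof.
  intros Hl Hc Hz.
  assert (HK : (0 <= K)%R) by (specialize (Hz 0%nat); simpl in Hz; lra).
  set (r := Rabs (Re s)). assert (Hr : (0 <= r)%R) by apply Rabs_pos.
  (* This slope uses up at most half of the decay rate - Re l; the denominator
     is 2 (r + 1) because r may vanish. *)
  set (e := (- Re l / (2 * (r + 1)))%R).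
  assert (He : (0 < e)%R) by (apply Rdiv_lt_0_compat; lra).
  assert (Hre : (r * e <= - Re l / 2)%R).
  { assert (E : (- Re l / 2 = r * e + e)%R) by (unfold e; field; lra). lra. }
  set (B := (r * (Rabs (ln c) + Rabs (ln e) + e * K) + Rabs (Im s) * PI)%R).
  apply (ex_series_le (V := R_CompleteNormedModule) _
           (fun n => scal (exp B) (exp (Re l / 2) ^ n)%R)).
  2: { apply (ex_series_scal_l (V := R_NormedModule)), ex_series_geom.
       rewrite Rabs_pos_eq by apply Rlt_le, exp_pos.
       rewrite <- exp_0. apply exp_increasing. lra. }
  intros n.
  change (Rabs (Cmod ((-1) ^ n * cexp l ^ n / cpow (z n) s))
          <= exp B * exp (Re l / 2) ^ n)%R.
  rewrite Rabs_pos_eq by apply Cmod_ge_0.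
  assert (Hpow : (exp (Re l / 2) ^ n = exp (INR n * (Re l / 2)))%R).
  { rewrite <- (Rpower_pow n) by apply exp_pos. unfold Rpower.
    now rewrite ln_exp. }
  unfold cpow. rewrite Cmod_div, Cmod_mult, Cmod_pow by apply cexp_neq_0.
  rewrite <- cexp_natC_mult, !Cmod_cexp.
  replace (Cmod (-1)) with 1%R.
  2: { rewrite Cmod_R, Rabs_left by lra. ring. }
  rewrite pow1, Rmult_1_l, Hpow. unfold Rdiv at 1.
  rewrite <- exp_Ropp, <- !exp_plus, Re_natC_mult, re_mult.
  apply exp_nondecreasing.
  assert (Hn := pos_INR n).
  assert (Hlog : (Rabs (Re s * Re (clog (z n)))
            <= r * (Rabs (ln c) + Rabs (ln e) + e * K) + r * e * INR n)%R).
  { rewrite Rabs_mult. fold r. rewrite Rmult_assoc, <- Rmult_plus_distr_l.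
    apply Rmult_le_compat_l; [exact Hr|].
    now apply abs_ln_le_linear. }
  assert (Harg : (Rabs (Im s * Im (clog (z n))) <= Rabs (Im s) * PI)%R).
  { rewrite Rabs_mult. apply Rmult_le_compat_l; [apply Rabs_pos|].
    apply Rabs_le, Im_clog_bounds. }
  apply Rabs_le_between in Hlog. apply Rabs_le_between in Harg.
  assert (r * e * INR n <= - Re l / 2 * INR n)%R by (apply Rmult_le_compat_r; lra).
  unfold B. lra.
Qed.

Lemma Re_mult_shift_le (l y : C) (n : nat) :
  (Re l < 0)%R -> (Re (l * (natC n + y)) <= Re (l * y))%R.
Proof.
  intros Hl. assert (Hn := pos_INR n).
  replace (l * (natC n + y)) with (natC n * l + l * y) by ring.
  change (Re (natC n * l + l * y)) with (Re (natC n * l) + Re (l * y))%R.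
  rewrite Re_natC_mult. nra.
Qed.

(** For alpha = 0 the bracket is n + y itself.  Its lower bound comes from
    |l| |n + y| >= |Re (l (n + y))| >= - Re (l y) > 0.  For positive alpha the
    numerator 1 - cexp (alpha l (n + y)) has modulus between
    1 - |cexp (alpha l y)| and 2. *)
Lemma qbracket_shift_bounds (l y : C) (alpha : nat) :
  (Re l < 0)%R -> (Re (l * y) < 0)%R ->
  exists c K : R, (0 < c)%R /\
    forall n, (c <= Cmod (qbracket (natC alpha * l) (natC n + y)) <= K + INR n)%R.
Proof.
  intros Hl Hy. destruct alpha as [|alpha].
  - assert (Hm : (0 < Cmod l)%R).
    { apply Cmod_gt_0. intros ->. simpl in Hl. lra. }
    exists (- Re (l * y) / Cmod l)%R, (Cmod y). split.
    { apply Rdiv_lt_0_compat; lra. }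
    intros n. rewrite qbracket_weight_0. split.
    + apply (Rmult_le_reg_l (Cmod l)); [exact Hm|].
      rewrite <- Cmod_mult.
      replace (Cmod l * (- Re (l * y) / Cmod l))%R with (- Re (l * y))%R
        by (field; lra).
      assert (H := re_le_Cmod (l * (natC n + y))).
      apply Rabs_le_between in H.
      assert (H' := Re_mult_shift_le l y n Hl). lra.
    + eapply Rle_trans; [apply Cmod_triangle|].
      unfold natC. rewrite Cmod_R, Rabs_pos_eq by apply pos_INR. lra.
  - set (k := S alpha). assert (Hk : (0 < k)%nat) by (unfold k; lia).
    assert (Hkl := Re_natC_mult_neg k l Hk Hl).
    assert (Hky : (Re (natC k * l * y) < 0)%R).
    { rewrite <- Cmult_assoc. now apply Re_natC_mult_neg. }
    set (L := natC k * l) in *.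
    assert (HD0 : 1 - cexp L <> 0).
    { now apply right_half_plane_neq_0, Re_one_minus_cexp_pos. }
    assert (HD : (0 < Cmod (1 - cexp L))%R) by now apply Cmod_gt_0.
    exists ((1 - exp (Re (L * y))) / Cmod (1 - cexp L))%R,
           (2 / Cmod (1 - cexp L))%R.
    assert (Hy1 : (exp (Re (L * y)) < 1)%R).
    { rewrite <- exp_0. now apply exp_increasing. }
    split. { apply Rdiv_lt_0_compat; lra. }
    intros n. rewrite qbracket_contracting, Cmod_div by assumption.
    assert (Hn := pos_INR n).
    assert (Hsmall : (Cmod (cexp (L * (natC n + y))) <= exp (Re (L * y)))%R).
    { rewrite Cmod_cexp. apply exp_nondecreasing. now apply Re_mult_shift_le. }
    assert (Hi : (0 < / Cmod (1 - cexp L))%R) by now apply Rinv_0_lt_compat.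
    set (w := cexp (L * (natC n + y))) in *. 
    assert (H1 : (1 <= Cmod (1 - w) + Cmod w)%R).
    { rewrite <- Cmod_1 at 1. replace (RtoC 1) with (1 - w + w) at 1 by ring.
      apply Cmod_triangle. }
    assert (H2 : (Cmod (1 - w) <= 1 + Cmod w)%R).
    { rewrite <- (Cmod_opp w). assert (H := Cmod_triangle 1 (- w)).
      rewrite Cmod_1 in H. exact H. }
    split.
    + apply Rmult_le_compat_r; lra.
    + apply Rle_trans with (2 / Cmod (1 - cexp L))%R; [|lra].
      apply Rmult_le_compat_r; lra.
Qed.

(** * Reindexing the partial zeta function *)

Lemma periodic_mult (chi : Z -> C) (p : Z) :
  (forall n, chi (n + p)%Z = chi n) ->
  forall (k : nat) (n : Z), chi (n + Z.of_nat k * p)%Z = chi n.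
Proof.
  intros H k n. induction k as [|k IH].
  - f_equal. lia.
  - rewrite <- IH, <- (H (n + Z.of_nat k * p)%Z). f_equal. lia.
Qed.

Lemma Cpow_neg_1_odd (F : nat) : Nat.Odd F -> (-1) ^ F = (-1 : C).
Proof.
  intros [k ->].
  rewrite Cpow_add_r, Cpow_mult_r, Cpow_1_r.
  replace ((-1) ^ 2) with (RtoC 1) by ring. rewrite Cpow_1_l. ring.
Qed.

Lemma qbracket_2_neq_0 (l : C) : (Re l < 0)%R -> qbracket l 2 <> 0.
Proof.
  intros Hl. rewrite qbracket_contracting by exact Hl.
  assert (H1 := Re_one_minus_cexp_pos l Hl).
  assert (H2 : (0 < Re (1 - cexp (l * 2)))%R).
  { apply Re_one_minus_cexp_pos. rewrite re_scal_r. lra. }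
  apply right_half_plane_neq_0 in H1. apply right_half_plane_neq_0 in H2.
  intros H. apply H2.
  replace (1 - cexp (l * 2))
    with ((1 - cexp (l * 2)) / (1 - cexp l) * (1 - cexp l)) by (field; exact H1).
  now rewrite H, Cmult_0_l.
Qed.

Theorem theorem5 :
  forall (q l : C) (hq : (Cmod q < 1)%R) (hl : cexp l = q)
    (d : nat) (chi : Z -> C)
    (hchi : character_of_conductor d chi) (hd : Nat.Odd d)
    (F : nat) (hF : Nat.Odd F) (hdF : Nat.divide d F)
    (alpha a : nat) (s x : C)
    (hx : (Cmod (cexp (l * (x + natC a))) < 1)%R),
  partial_zeta l chi s x a F alpha =
    (qbracket l 2 / qbracket (natC F * l) 2)
      * (q ^ a * (-1) ^ a * chi (Z.of_nat a))
      / cpow (qbracket (natC alpha * l) (natC F)) s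
      * euler_hurwitz_zeta (natC F * l) s ((x + natC a) / natC F) alpha.
Proof.
  intros q l hq hl d chi [hchi _] hd F hF hdF alpha a s x hx.
  subst q. apply Cmod_cexp_lt_1 in hq. apply Cmod_cexp_lt_1 in hx.
  assert (HF : (0 < F)%nat) by (destruct hF; lia).
  assert (HF0 := natC_neq_0 F HF).
  assert (HL := Re_natC_mult_neg F l HF hq).
  set (y := (x + natC a) / natC F).
  assert (Ey : natC F * l * y = l * (x + natC a)) by (unfold y; field; exact HF0).
  assert (Hsum : ex_series (fun n => Cmod ((-1) ^ n * cexp (natC F * l) ^ n
              / cpow (qbracket (natC alpha * (natC F * l)) (natC n + y)) s))).
  { destruct (qbracket_shift_bounds (natC F * l) y alpha HL) as (c & K & Hc & HK).
    - now rewrite Ey.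
    - now apply ex_series_geometric_over_cpow with (c := c) (K := K). }
  unfold partial_zeta, euler_hurwitz_zeta.
  set (P := cpow (qbracket (natC alpha * l) (natC F)) s).
  assert (HP : P <> 0) by apply cexp_neq_0.
  rewrite (CSeries_ext _ (fun n => (cexp l ^ a * (-1) ^ a * chi (Z.of_nat a) / P)
     * ((-1) ^ n * cexp (natC F * l) ^ n
              / cpow (qbracket (natC alpha * (natC F * l)) (natC n + y)) s))).
  - rewrite (CSeries_scal_l _ _ Hsum). field.
    split; [now apply qbracket_2_neq_0 | exact HP].
  - intros n.
    assert (Hchi : chi (Z.of_nat (a + n * F)) = chi (Z.of_nat a)).
    { destruct hdF as [k ->].
      rewrite <- (periodic_mult chi (Z.of_nat d) (dirichlet_periodic _ _ hchi)
                    (n * k) (Z.of_nat a)).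
      f_equal. lia. }
    assert (Em : x + natC (a + n * F) = natC F * (natC n + y)).
    { unfold y, natC. rewrite plus_INR, mult_INR, RtoC_plus, RtoC_mult.
      fold (natC F) (natC a) (natC n). field. exact HF0. }
    assert (Hm : (Re (l * (x + natC (a + n * F))) < 0)%R).
    { rewrite Em, Cmult_assoc, (Cmult_comm l).
      eapply Rle_lt_trans; [apply Re_mult_shift_le|]; rewrite ?Ey; assumption. }
    cbv zeta. rewrite Hchi, (cpow_qbracket_rescale l _ s F alpha HF hq Hm).
    fold P.
    replace ((x + natC (a + n * F)) / natC F) with (natC n + y)
      by (rewrite Em; field; exact HF0).
    rewrite !Cpow_add_r, (Nat.mul_comm n F), !Cpow_mult_r, (Cpow_neg_1_odd F hF).
    rewrite <- (cexp_natC_mult F). field.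
    split; [apply cexp_neq_0 | exact HP].
Qed.
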